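(* Let $A=\langle X,Z\rangle\subseteq M_2(\mathbb C)$, where $$X=\begin{pmatrix}0&1\\1&0\end{pmatrix},\qquad Z=\begin{pmatrix}1&0\\0&-1\end{pmatrix}$$ are Pauli operators. Then $A=M_2(\mathbb C)$. The context category $\mathcal C_A$ contains, among others, the maximal commutative subalgebras $$\langle X\rangle\cong\mathbb C\oplus\mathbb C,\qquad\langle Z\rangle\cong\mathbb C\oplus\mathbb C,$$ corresponding respectively to the eigenbases of $X$ and $Z$. However, the algebra $\langle X,Z\rangle$ is noncommutative and therefore does not define an object of $\mathcal C_A$. Thus $\mathcal C_A$ contains incompatible local classical contexts that cannot be merged into a single global commutative context.
   Context: $\langle S\rangle$ denotes the (unital) subalgebra of $M_2(\mathbb C)$ generated by $S$. The context category $\mathcal C_A$ is the category whose objects are the commutative subalgebras of $A$ (contexts) and whose morphisms are inclusions. Two contexts cannot be merged into a single commutative context if no commutative subalgebra of $A$ contains both. *)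

(* Defs.v *)
From HB Require Import structures.
From mathcomp Require Import all_boot all_order all_algebra all_field.
From mathcomp Require Import reals complex.

Set Implicit Arguments.
Unset Strict Implicit.
Unset Printing Implicit Defensive.

Import GRing.Theory.
Local Open Scope ring_scope.

Record category := Category {
  obj :> Type;
  hom : obj -> obj -> Type;
  idm : forall a, hom a a;
  comp : forall a b c, hom b c -> hom a b -> hom a c;
  comp_idl : forall a b (f : hom a b), comp (idm b) f = f;
  comp_idr : forall a b (f : hom a b), comp f (idm a) = f;
  compA : forall a b c d (h : hom c d) (g : hom b c) (f : hom a b),
    comp h (comp g f) = comp (comp h g) f }.

(* The inner brackets are the linear span, the outer ones the smallest unital
   subalgebra containing it. *)
Definition alg_gen (K : fieldType) (aT : falgType K) (s : seq aT) :
  {aspace aT} := <<<<s>>%VS>>%AS.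

Definition commutative_subalg (K : fieldType) (aT : falgType K)
    (B : {aspace aT}) : Prop :=
  {in B &, commutative (@GRing.mul aT)}.

(* An element of {aspace aT} may have a unit different from that of aT, so
   sharing the unit of A has to be required separately. *)
Record context (K : fieldType) (aT : falgType K) (A : {aspace aT}) := Context {
  ctx_alg :> {aspace aT};
  ctx_sub : (ctx_alg <= A)%VS;
  ctx_unit : algid A \in ctx_alg;
  ctx_comm : commutative_subalg ctx_alg }.

Definition ctx_incl (K : fieldType) (aT : falgType K) (A : {aspace aT})
    (B D : context A) : Prop := (B <= D)%VS.

Definition context_category (K : fieldType) (aT : falgType K)
    (A : {aspace aT}) : category :=
  @Category (context A) (@ctx_incl K aT A)
    (fun B => subvv B)
    (fun B D E (g : ctx_incl D E) (f : ctx_incl B D) => subv_trans f g)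
    (fun B D f => bool_irrelevance _ f)
    (fun B D f => bool_irrelevance _ f)
    (fun B D E F h g f => bool_irrelevance _ _).

Definition maximal_context (K : fieldType) (aT : falgType K)
    (A : {aspace aT}) (B : context A) : Prop :=
  forall D : context A, ctx_incl B D -> D = B :> {aspace aT}.

Definition mergeable (K : fieldType) (aT : falgType K) (A : {aspace aT})
    (B D : context A) : Prop :=
  exists E : context A, ctx_incl B E /\ ctx_incl D E.

Definition alg_isomorphic (K : fieldType) (A B : algType K) : Prop :=
  exists f : {lrmorphism A -> B}, bijective f.

(* A basis of K^n is encoded by the invertible matrix P whose columns are the
   basis vectors; matrices act on column vectors. *)
Definition diagonal_in (K : fieldType) (n : nat) (P M : 'M[K]_n) : Prop :=
  forall j, exists a : K, M *m col j P = a *: col j P.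

Definition eigenbasis (K : fieldType) (n : nat) (P T : 'M[K]_n) : Prop :=
  P \in unitmx /\ diagonal_in P T.

(* T has an eigenbasis, and with respect to any of its eigenbases B is the
   algebra of all diagonal operators. *)
Definition corresponds_to_eigenbasis (K : fieldType) (n : nat)
    (B : {aspace 'M[K]_n.+1}) (T : 'M[K]_n.+1) : Prop :=
  (exists P, eigenbasis P T) /\
  (forall P, eigenbasis P T -> forall M, M \in B <-> diagonal_in P M).

Definition mx22 (K : fieldType) (a b c d : K) : 'M[K]_2 :=
  \matrix_(i < 2, j < 2) nth 0 (nth [::] [:: [:: a; b]; [:: c; d]] i) j.

Definition pauliX (R : realType) : 'M[R[i]]_2 := mx22 0 1 1 0.
Definition pauliZ (R : realType) : 'M[R[i]]_2 := mx22 1 0 0 (-1).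

(* Main.v *)
Require Import Defs.
From HB Require Import structures.
From mathcomp Require Import all_boot all_order all_algebra all_field.
From mathcomp Require Import reals complex.
From mathcomp Require Import ring.

Set Implicit Arguments.
Unset Strict Implicit.
Unset Printing Implicit Defensive.

Import GRing.Theory.
Local Open Scope ring_scope.

(** For a nonscalar matrix T of size two, three subspaces coincide: the span of
    1 and T, the algebra generated by T, and the commutant of T
    (commute_nonscalar_mx2, mem_alg_gen_mx2).  This single fact yields all that
    is claimed of the contexts generated by X and by Z.

    - The algebra of T is commutative, being contained in the span of 1 and T;
      it is maximal, since a commutative algebra containing T is contained in
      the commutant of T (gen_context_maximal).
    - If T has an eigenbasis P, the operators diagonal in P commute with T, so
      they lie in the algebra of T; the converse holds as 1 and T are diagonal
      in P (mem_alg_gen_diagonal).  Conjugating by P and reading off the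
      diagonal then identifies this algebra with the product of two copies of
      the field (diagonal_alg_isomorphic).

    Both X and Z are nonscalar and have an eigenbasis.  The matrices 1, X, Z
    and XZ span all matrices of size two (pauli_expansion), so X and Z generate
    the whole matrix algebra.  Finally XZ and ZX differ, which shows at once
    that the whole algebra is not commutative, hence not a context, and that no
    context contains both X and Z (mergeable_commute). *)

(** * Matrices of size two *)

Lemma ord2P (P : 'I_2 -> Prop) : P 0 -> P 1 -> forall i, P i.
Proof.
move=> P0 P1 i; case: (unliftP 0 i) => [j ->|->] //.
by rewrite ord1 [lift _ _](_ : _ = 1) //; apply: val_inj.
Qed.

Lemma matrix2P (T : Type) (A B : 'M[T]_2) :
  A 0 0 = B 0 0 -> A 0 1 = B 0 1 -> A 1 0 = B 1 0 -> A 1 1 = B 1 1 -> A = B.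
Proof. by move=> *; apply/matrixP; apply: ord2P; apply: ord2P. Qed.

Lemma mulmx2E (K : pzSemiRingType) (A B : 'M[K]_2) i j :
  (A *m B) i j = A i 0 * B 0 j + A i 1 * B 1 j.
Proof.
rewrite mxE 2!big_ord_recl big_ord0 addr0.
by rewrite [lift _ _](_ : _ = 1) //; apply: val_inj.
Qed.

(** * Unital subalgebras generated by a sequence *)

Lemma mem_alg_gen (K : fieldType) (aT : falgType K) (s : seq aT) (x : aT) :
  x \in s -> x \in alg_gen s.
Proof. by move=> xs; apply: (subvP (sub_agenv _)); apply: memv_span. Qed.

Lemma mem1_alg_gen (K : fieldType) (aT : falgType K) (s : seq aT) :
  1 \in alg_gen s.
Proof. by have := sub1_agenv <<s>>%VS; rewrite -memvE. Qed.

Lemma alg_gen_sub (K : fieldType) (aT : falgType K) (s : seq aT)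
    (B : {aspace aT}) :
  1 \in B -> {subset s <= B} -> (alg_gen s <= B)%VS.
Proof.
move=> B1 sB; apply: agenv_sub_modl; first by rewrite -memvE.
by apply: prodv_sub => //; apply/span_subvP.
Qed.

(** * The commutant of a nonscalar matrix of size two *)

Lemma nonscalar_mx2P (K : fieldType) (T : 'M[K]_2) :
  ~~ is_scalar_mx T -> [\/ T 0 1 != 0, T 1 0 != 0 | T 1 1 - T 0 0 != 0].
Proof.
move=> nsT; have [T01|] := eqVneq (T 0 1) 0; last by constructor 1.
have [T10|] := eqVneq (T 1 0) 0; last by constructor 2.
have [/eqP|] := eqVneq (T 1 1 - T 0 0) 0; last by constructor 3.
rewrite subr_eq0 => /eqP T11; case/is_scalar_mxP: nsT; exists (T 0 0).
by apply: matrix2P; rewrite !mxE /= ?mulr1n ?mulr0n.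
Qed.

(** Modulo scalars, M and T are the vectors (M01, M10, M11 - M00) and
    (T01, T10, T11 - T00), and commuting means that the cross product of these
    vectors is zero.  The second one is nonzero, so the first is a multiple b
    of it, and M - b T is then scalar. *)
Lemma commute_nonscalar_mx2 (K : fieldType) (T M : 'M[K]_2) :
  ~~ is_scalar_mx T -> M *m T = T *m M -> exists a b, M = a%:M + b *: T.
Proof.
move=> nsT MT; pose E i j := congr1 (fun A : 'M_2 => A i j) MT.
have := E 1 0; have := E 0 1; have := E 0 0; rewrite !mulmx2E {E MT}.
set p := T 0 0; set q := T 0 1; set r := T 1 0; set s := T 1 1.
set x := M 0 0; set y := M 0 1; set z := M 1 0; set t := M 1 1.
move=> E00 E01 E10.
have yr : y * r = z * q by apply: (addrI (x * p)); rewrite E00; ring.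
have ys : y * (s - p) = (t - x) * q.
  apply: (addrI (x * q + y * p)); transitivity (x * q + y * s); first by ring.
  by rewrite E01; ring.
have zs : z * (s - p) = (t - x) * r.
  apply: (addrI (z * p + x * r)); transitivity (s * z + r * x); first by ring.
  by rewrite addrC -E10; ring.
suff [b [yb zb tb]] : exists b, [/\ y = b * q, z = b * r & t - x = b * (s - p)].
  exists (x - b * p), b; apply: matrix2P;
    rewrite !mxE /= ?mulr1n ?mulr0n ?add0r //.
    by rewrite -/x -/p; ring.
  by rewrite -/t -/s -(subrK x t) tb; ring.
have scale (u v w k : K) : w != 0 -> u * w = v * k -> u = v / w * k.
  by move=> w0 uw; rewrite mulrAC -uw mulfK.
case: (nonscalar_mx2P nsT); rewrite -/p -/q -/r -/s => nz;
  [exists (y / q) | exists (z / r) | exists ((t - x) / (s - p))];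
  by split; apply: scale.
Qed.

(** The algebra generated by T lies in the commutant of T; conversely the
    commutant is spanned by 1 and T, hence lies in that algebra. *)
Lemma mem_alg_gen_mx2 (K : fieldType) (T M : 'M[K]_2) :
  ~~ is_scalar_mx T -> M \in alg_gen [:: T] <-> M *m T = T *m M.
Proof.
move=> nsT; split=> [MT|/(commute_nonscalar_mx2 nsT)[a [b ->]]].
  have cT : (alg_gen [:: T] <= 'C[T])%VS.
    apply: alg_gen_sub => [|x]; rewrite ?cent1v1 // inE => /eqP->.
    exact: cent1v_id.
  exact/(@cent1vP _ _ M T)/(subvP cT).
by rewrite -scalemx1 rpredD // rpredZ ?mem1_alg_gen // mem_alg_gen ?inE.
Qed.

(** * Operators diagonal in a common basis *)

Lemma col_mulmx (K : pzSemiRingType) m n p (A : 'M[K]_(m, n))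
    (B : 'M_(n, p)) j :
  col j (A *m B) = A *m col j B.
Proof. by rewrite !colE mulmxA. Qed.

(** Gathering the eigenvalues into one vector d turns the columnwise condition
    into an identity of matrices, which can be multiplied and conjugated. *)
Lemma diagonal_inP (K : fieldType) n (P M : 'M[K]_n) :
  diagonal_in P M <-> exists d, M *m P = P *m diag_mx d.
Proof.
split=> [/fin_all_exists[a Ma]|[d MP] j].
  exists (\row_j a j); apply/matrixP=> i j.
  have := Ma j; rewrite -col_mulmx => /colP/(_ i); rewrite mxE => ->.
  by rewrite mul_mx_diag !mxE mulrC.
exists (d 0 j); rewrite -col_mulmx MP; apply/colP=> i.
by rewrite mul_mx_diag !mxE mulrC.
Qed.

Lemma diagonal_in_commute (K : fieldType) n (P M N : 'M[K]_n) :
  P \in unitmx -> diagonal_in P M -> diagonal_in P N -> M *m N = N *m M.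
Proof.
move=> uP /diagonal_inP[d Md] /diagonal_inP[e Ne]; apply: (can_inj (mulmxK uP)).
by rewrite -!mulmxA Md Ne !mulmxA Md Ne -!mulmxA diag_mxC.
Qed.

(** Two operators diagonal in the same basis commute, so the operators diagonal
    in an eigenbasis of T belong to the commutant of T, which is the algebra
    generated by T. *)
Lemma mem_alg_gen_diagonal (K : fieldType) (P T M : 'M[K]_2) :
  ~~ is_scalar_mx T -> eigenbasis P T ->
  M \in alg_gen [:: T] <-> diagonal_in P M.
Proof.
move=> nsT [uP dT]; rewrite (mem_alg_gen_mx2 M nsT); split; last first.
  by move=> dM; apply: diagonal_in_commute dT.
case/(commute_nonscalar_mx2 nsT) => a [b ->] j; have [t Tt] := dT j.
exists (a + b * t).
by rewrite mulmxDl mul_scalar_mx -scalemxAl Tt scalerA scalerDl.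
Qed.

(** Conjugation by P carries B onto the diagonal matrices, and reading off the
    two diagonal entries is the isomorphism. *)
Lemma diagonal_alg_isomorphic (K : fieldType) (P : 'M[K]_2)
    (B : {aspace 'M[K]_2}) :
  P \in unitmx -> (forall M, M \in B <-> diagonal_in P M) ->
  alg_isomorphic (subvs_of B) (K^o * K^o)%type.
Proof.
move=> uP BP; pose D (M : 'M[K]_2) := invmx P *m M *m P.
have diagD M : M \in B -> exists d, D M = diag_mx d.
  move=> /BP/diagonal_inP[d MP]; exists d.
  by rewrite /D -mulmxA MP mulKmx.
have DK d : D (P *m diag_mx d *m invmx P) = diag_mx d.
  by rewrite /D !mulmxA mulVmx // mul1mx mulmxKV.
have D_inj : injective D.
  by move=> M N /(can_inj (mulmxK uP))/(can_inj (mulKVmx uP)).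
(* The unit of the ring of elements of B is algid B, which a priori could be an
   idempotent other than the identity matrix. *)
have algid_B : algid B = 1.
  apply/eqP; rewrite algid_eq1; apply/BP/diagonal_inP.
  by exists (const_mx 1); rewrite diag_const_mx mulmx1 mul1mx.
pose f (u : subvs_of B) : K^o * K^o := (D (vsval u) 0 0, D (vsval u) 1 1).
have f_linear : linear f.
  move=> a u v; rewrite /f (_ : D _ = a *: D (vsval u) + D (vsval v)) ?mxE //.
  by rewrite /D [vsval _]linearP /= mulmxDr mulmxDl -scalemxAr -scalemxAl.
have f_monoid : monoid_morphism f.
  split=> [|u v]; first by rewrite /f /= algid_B /D mulmx1 mulVmx // !mxE.
  rewrite /f /= (_ : D (vsval u * vsval v) = D (vsval u) *m D (vsval v)).
    have [d ->] := diagD _ (subvsP u); have [e ->] := diagD _ (subvsP v).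
    by rewrite mulmx_diag !mxE /= !mulr1n.
  by rewrite /D -mulmxE !mulmxA mulmxK.
pose F : {lrmorphism subvs_of B -> K^o * K^o} := HB.pack f
  (GRing.isLinear.Build _ _ _ _ f f_linear)
  (GRing.isMonoidMorphism.Build _ _ f f_monoid).
exists F.
pose diag2 (x : K^o * K^o) : 'rV[K]_2 := \row_j (if j == 0 then x.1 else x.2).
have BG x : P *m diag_mx (diag2 x) *m invmx P \in B.
  by apply/BP/diagonal_inP; exists (diag2 x); rewrite mulmxKV.
exists (fun x => Subvs (BG x)) => [u|[x y]]; last first.
  by rewrite /= /f /= DK !mxE.
apply/val_inj/D_inj; rewrite /= DK; have [d Dd] := diagD _ (subvsP u).
by rewrite /= /f /= Dd; congr diag_mx; apply/rowP; apply: ord2P; rewrite !mxE.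
Qed.

(** * The context generated by a nonscalar matrix of size two *)

Section MaximalContexts.

Variables (K : fieldType) (A : {aspace 'M[K]_2}) (T : 'M[K]_2).
Hypotheses (A1 : 1 \in A) (AT : T \in A) (nsT : ~~ is_scalar_mx T).

Lemma alg_gen1_sub : (alg_gen [:: T] <= A)%VS.
Proof. by apply: alg_gen_sub => // M; rewrite inE => /eqP->. Qed.

Lemma alg_gen1_comm : commutative_subalg (alg_gen [:: T]).
Proof.
move=> M N /(mem_alg_gen_mx2 M nsT) MT.
case/(mem_alg_gen_mx2 N nsT)/(commute_nonscalar_mx2 nsT) => a [b ->].
by rewrite [LHS]mulmxDr [RHS]mulmxDl scalar_mxC -scalemxAr -scalemxAl MT.
Qed.

Lemma algid_alg_gen s : algid A \in alg_gen s.
Proof. by have -> := eqP (etrans (algid_eq1 A) A1); apply: mem1_alg_gen. Qed.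

Definition gen_context : context A :=
  Context alg_gen1_sub (algid_alg_gen _) alg_gen1_comm.

(** A commutative algebra containing T lies in the commutant of T. *)
Lemma gen_context_maximal : maximal_context gen_context.
Proof.
move=> D TD; apply/val_inj/eqP; rewrite eqEsubv; apply/andP; split=> //.
apply/subvP=> M DM; apply/(mem_alg_gen_mx2 M nsT).
by apply: ctx_comm (subvP TD T _); rewrite ?mem_alg_gen ?inE.
Qed.

Lemma gen_context_eigenbasis :
  (exists P, eigenbasis P T) -> corresponds_to_eigenbasis gen_context T.
Proof. by split=> // P PT M; apply: mem_alg_gen_diagonal. Qed.

Lemma gen_context_isomorphic :
  (exists P, eigenbasis P T) ->
  alg_isomorphic (subvs_of gen_context) (K^o * K^o)%type.
Proof.
case=> P PT; apply: (@diagonal_alg_isomorphic _ P); first by case: PT.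
by move=> M; apply: mem_alg_gen_diagonal.
Qed.

End MaximalContexts.

Lemma mergeable_commute (K : fieldType) (aT : falgType K) (A : {aspace aT})
    (B D : context A) (x y : aT) :
  x \in ctx_alg B -> y \in ctx_alg D -> mergeable B D -> x * y = y * x.
Proof.
move=> Bx Dy [E [/subvP BE /subvP DE]].
by apply: (ctx_comm (c := E)); [apply: BE | apply: DE].
Qed.

(** * The Pauli matrices *)

Section Pauli.

Variable R : realType.
Local Notation X := (pauliX R).
Local Notation Z := (pauliZ R).

Lemma two_neq0 : 2%:R != 0 :> R[i].
Proof. by rewrite Num.Theory.pnatr_eq0. Qed.

Lemma pauliX_nonscalar : ~~ is_scalar_mx X.
Proof.
apply/negP=> /is_scalar_mxP[a /matrixP/(_ 0 1)]; rewrite !mxE /= mulr0n.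
by move/eqP; rewrite oner_eq0.
Qed.

Lemma pauliZ_nonscalar : ~~ is_scalar_mx Z.
Proof.
apply/negP=> /is_scalar_mxP[a /matrixP Za].
have := Za 1 1; have := Za 0 0; rewrite !mxE /= mulr1n => <- /eqP.
by rewrite eq_sym -subr_eq0 opprK -[_ + _]/(2%:R) (negPf two_neq0).
Qed.

Lemma pauliX_eigenbasis : exists P, eigenbasis P X.
Proof.
(* This is the Hadamard matrix up to scaling; its square is 2, so half of it is
   its inverse. *)
exists (mx22 1 1 1 (-1)); split.
  have P2 : mx22 1 1 1 (-1) *m mx22 1 1 1 (-1) = 2%:R%:M :> 'M[R[i]]_2.
    by apply: matrix2P; rewrite mulmx2E !mxE /= ?mulr1n ?mulr0n; ring.
  suff /mulmx1_unit[] : mx22 1 1 1 (-1) *m (2%:R^-1 *: mx22 1 1 1 (-1))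
                        = 1%:M :> 'M[R[i]]_2 by [].
  by rewrite -scalemxAr P2 scale_scalar_mx mulVf ?two_neq0.
apply/diagonal_inP; exists (\row_j (if j == 0 then 1 else -1)).
by apply: matrix2P; rewrite mul_mx_diag mulmx2E !mxE /=; ring.
Qed.

Lemma pauliZ_eigenbasis : exists P, eigenbasis P Z.
Proof.
exists 1%:M; split; first exact: unitmx1.
apply/diagonal_inP; exists (\row_j (if j == 0 then 1 else -1)).
by rewrite mul1mx mulmx1; apply: matrix2P; rewrite !mxE.
Qed.

Lemma pauli_noncommute : X * Z <> Z * X.
Proof.
move/matrixP/(_ 0 1); rewrite -!mulmxE !mulmx2E !mxE /=.
rewrite !(mulr0, mul0r, mulr1, mul1r, addr0, add0r) => /eqP.
by rewrite eq_sym -subr_eq0 opprK -[_ + _]/(2%:R) (negPf two_neq0).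
Qed.

(** This is the expansion in the Pauli basis, where XZ, a scalar multiple of the
    third Pauli matrix Y, takes the place of Y. *)
Lemma pauli_expansion (M : 'M[R[i]]_2) :
  M = ((M 0 0 + M 1 1) / 2%:R) *: 1 + ((M 0 1 + M 1 0) / 2%:R) *: X
    + ((M 0 0 - M 1 1) / 2%:R) *: Z + ((M 1 0 - M 0 1) / 2%:R) *: (X * Z).
Proof.
have nz2 := two_neq0.
rewrite -mulmxE; apply: matrix2P;
  by rewrite !(mxE, mulmx2E) /= ?mulr1n ?mulr0n; field.
Qed.

Lemma alg_gen_pauli : alg_gen [:: X; Z] = {: 'M[R[i]]_2}%AS.
Proof.
apply/val_inj/eqP; rewrite eqEsubv subvf /=; apply/subvP=> M _.
have XA : X \in alg_gen [:: X; Z] by rewrite mem_alg_gen ?inE ?eqxx.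
have ZA : Z \in alg_gen [:: X; Z] by rewrite mem_alg_gen ?inE ?eqxx ?orbT.
rewrite [M]pauli_expansion.
by rewrite !rpredD // rpredZ ?mem1_alg_gen ?memvM.
Qed.

End Pauli.

Theorem proposition11 (R : realType) :
  let X := pauliX R in
  let Z := pauliZ R in
  let A := alg_gen [:: X; Z] in
  [/\ A = {: 'M[R[i]]_2}%AS,
      exists cX cZ : obj (context_category A),
        [/\ ctx_alg cX = alg_gen [:: X] /\ ctx_alg cZ = alg_gen [:: Z],
            [/\ maximal_context cX,
                alg_isomorphic (subvs_of cX) (R[i]^o * R[i]^o)%type
              & corresponds_to_eigenbasis cX X],
            [/\ maximal_context cZ,
                alg_isomorphic (subvs_of cZ) (R[i]^o * R[i]^o)%type
              & corresponds_to_eigenbasis cZ Z],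
            exists c : obj (context_category A),
              ctx_alg c <> ctx_alg cX /\ ctx_alg c <> ctx_alg cZ
          & ~ mergeable cX cZ],
      ~ commutative_subalg A
    & ~ exists c : obj (context_category A), ctx_alg c = A].
Proof.
move=> X Z A.
have XA : X \in A by rewrite mem_alg_gen ?inE ?eqxx.
have ZA : Z \in A by rewrite mem_alg_gen ?inE ?eqxx ?orbT.
have A1 : 1 \in A := mem1_alg_gen _.
have A_nc : ~ commutative_subalg A.
  by move=> Ac; apply: (@pauli_noncommute R); apply: Ac.
have nsX := pauliX_nonscalar R; have nsZ := pauliZ_nonscalar R.
have eX := pauliX_eigenbasis R; have eZ := pauliZ_eigenbasis R.
(* The scalars form a third context, distinct from the two given ones because
   X and Z are not scalar. *)
have C1_sub : (1%AS <= A)%VS by rewrite -memvE.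
have C1_unit : algid A \in 1%AS.
  by have -> := eqP (etrans (algid_eq1 A) A1); rewrite memv_line.
have C1_comm : commutative_subalg (1%AS : {aspace 'M[R[i]]_2}).
  by move=> M N /vlineP[a ->] _; rewrite -scalerAl -scalerAr mulr1 mul1r.
have C1_neq T : ~~ is_scalar_mx T ->
    (1%AS : {aspace 'M[R[i]]_2}) <> alg_gen [:: T].
  move=> nsT C1T; have : T \in alg_gen [:: T] by rewrite mem_alg_gen ?inE.
  rewrite -C1T => /vlineP[a Ta]; case/is_scalar_mxP: nsT; exists a.
  by rewrite Ta scalemx1.
split=> //; first exact: alg_gen_pauli.
  exists (gen_context A1 XA nsX), (gen_context A1 ZA nsZ); split=> //.
  - split; [exact: gen_context_maximal | exact: gen_context_isomorphic |].
    exact: gen_context_eigenbasis.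
  - split; [exact: gen_context_maximal | exact: gen_context_isomorphic |].
    exact: gen_context_eigenbasis.
  - by exists (Context C1_sub C1_unit C1_comm); split; apply: C1_neq.
  move=> /(mergeable_commute (x := X) (y := Z)) XZ.
  by apply: (@pauli_noncommute R); apply: XZ; rewrite mem_alg_gen ?inE.
by case=> c cA; apply: A_nc; rewrite -cA; apply: ctx_comm.
Qed.
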